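(* Let $p>2$ and fix $0\le\ell<u$ and $n\ge2$. Then $\operatorname{vol}(\breve{U}^*_p(\boldsymbol\xi))$, where $\boldsymbol\xi=(\ell,\xi_1,\ldots,\xi_{n-1},u)$, has a unique minimizer satisfying $\ell<\xi_1<\cdots<\xi_{n-1}<u$.
   Context: Let $f(x):=x^p$ on $[\ell,u]$. Write $\xi_0:=\ell$, $\xi_n:=u$, put $\tau_0:=\ell$, $\tau_{n+1}:=u$ and, for $i=1,\ldots,n$, $$\tau_i:=\frac{[f(\xi_i)-f'(\xi_i)\xi_i]-[f(\xi_{i-1})-f'(\xi_{i-1})\xi_{i-1}]}{f'(\xi_{i-1})-f'(\xi_i)},$$ the abscissa of the intersection of the tangent lines to $f$ at $\xi_{i-1}$ and $\xi_i$. Let $g:[\ell,u]\to\mathbb{R}$ be the piecewise-linear function whose graph connects, in order, $(\ell,f(\ell))$, the points $(\tau_i,\ f(\xi_i)+f'(\xi_i)(\tau_i-\xi_i))$ for $i=1,\ldots,n$, and $(u,f(u))$. With $s:=\frac{f(u)-f(\ell)}{u-\ell}$, the set $\breve{U}^*_p(\boldsymbol\xi)$ is the closure of the convex hull of $$\left\{(x,y,z)\in\mathbb{R}^3:\ (f(\ell)-s\ell)z+sx\ge y\ge z\,g(x/z),\ uz\ge x\ge \ell z,\ 1\ge z>0,\ y\ge 0\right\}.$$ $\operatorname{vol}$ denotes 3-dimensional volume. *)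

(* Defs.v *)
From HB Require Import structures.
From mathcomp Require Import all_boot all_order all_algebra.
From mathcomp Require Import all_classical all_reals all_analysis.

Set Implicit Arguments.
Unset Strict Implicit.
Unset Printing Implicit Defensive.

Import Order.TTheory GRing.Theory Num.Theory.
Import numFieldNormedType.Exports.

Local Open Scope classical_set_scope.
Local Open Scope ring_scope.

(* The points xi_0, ..., xi_n are stored in a tuple xi of size n.+1; the
   entries tau_i and eta_i below are meant for i <= n.+1. *)

(* x |-> x^p on [0, +oo[, extended evenly to R so that, for p > 1, the
   (two-sided) derivative f^`() at 0 exists and equals the one-sided derivative
   of x^p there (powR itself is the constant 1 on ]-oo, 0[). *)
Definition fpow (R : realType) (p x : R) : R := `|x| `^ p.

Definition strict_grid (R : realType) (l u : R) (n : nat)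
    (xi : n.+1.-tuple R) : Prop :=
  [/\ xi`_0 = l, xi`_n = u & forall i, (i < n)%N -> xi`_i < xi`_i.+1].

Section under_estimator.
Context (R : realType) (p l u : R) (n : nat) (xi : n.+1.-tuple R).
Let f := fpow p.

Definition tau (i : nat) : R :=
  if i == 0%N then l else
  if i == n.+1 then u else
  ((f xi`_i - f^`()%classic xi`_i * xi`_i)
   - (f xi`_i.-1 - f^`()%classic xi`_i.-1 * xi`_i.-1))
  / (f^`()%classic xi`_i.-1 - f^`()%classic xi`_i).

Definition eta (i : nat) : R :=
  if i == 0%N then f l else
  if i == n.+1 then f u else
  f xi`_i + f^`()%classic xi`_i * (tau i - xi`_i).

End under_estimator.

(* Value at t of the piecewise-linear function whose graph joins in order the
   points a :: s (with increasing abscissas); the value for t outside the range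
   of the abscissas is irrelevant. *)
Fixpoint pwlin (R : realType) (a : R * R) (s : seq (R * R)) (t : R) : R :=
  match s with
  | [::] => a.2
  | b :: s' =>
      if t <= b.1 then a.2 + (b.2 - a.2) / (b.1 - a.1) * (t - a.1)
      else pwlin b s' t
  end.

Definition gpl (R : realType) (p l u : R) (n : nat) (xi : n.+1.-tuple R) :
    R -> R :=
  pwlin (tau p l u xi 0, eta p l u xi 0)
        [seq (tau p l u xi i, eta p l u xi i) | i <- iota 1 n.+1].

Definition Ubase (R : realType) (p l u : R) (n : nat) (xi : n.+1.-tuple R) :
    set (R^o * R^o * R^o) :=
  let f := fpow p in
  let s := (f u - f l) / (u - l) in
  [set w | let x := w.1.1 in let y := w.1.2 in let z := w.2 in
    [/\ y <= (f l - s * l) * z + s * x /\ z * gpl p l u xi (x / z) <= y,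
        x <= u * z /\ l * z <= x,
        0 < z /\ z <= 1
      & 0 <= y]].

Definition conv_hull (R : realType) (M : lmodType R) (A : set M) : set M :=
  smallest (@convex_set R M) A.

Definition Ustar (R : realType) (p l u : R) (n : nat) (xi : n.+1.-tuple R) :
    set (R^o * R^o * R^o) :=
  closure (conv_hull (Ubase p l u xi)).

Definition vol3 (R : realType) (A : set (R * R * R)) : \bar R :=
  ((@lebesgue_measure R \x @lebesgue_measure R) \x @lebesgue_measure R)%E A.

(* Main.v *)
Require Import Defs.
From HB Require Import structures.
From mathcomp Require Import all_boot all_order all_algebra.
From mathcomp Require Import all_classical all_reals all_analysis.
From mathcomp Require Import measurable_realfun.
From mathcomp Require Import ring lra.

Set Implicit Arguments.
Unset Strict Implicit.
Unset Printing Implicit Defensive.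

Import Order.TTheory GRing.Theory Num.Theory.
Import numFieldNormedType.Exports.

Local Open Scope classical_set_scope.
Local Open Scope ring_scope.

(** The volume is a cone volume: each slice of the set at height z is z times
the slice at height 1, which is the planar region between the chord of f on
[l, u] and g.  Integrating z ^ 2 over [0, 1], the volume is one third of the
area between chord and g ([vol3_Ustar]), so minimizing it means maximizing the
area under g.  Moreover g is the upper envelope of the tangents to f at the
points xi_i ([gpl_envelope]).

Existence.  The area under the envelope of the tangents at l, u and n - 1
further points makes sense for arbitrary points of [l, u], in any order and
possibly repeated, and depends continuously on them, so it has a maximum on the
compact cube ([exists_max_under_area]).  In a maximal family the points are
distinct from each other and from l and u, for otherwise one of them could be
moved, at no loss, to a place where the envelope lies strictly below f
([max_points_uniq]).  Sorting such a family gives a strict grid.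

Stationarity.  On [tau_i, tau_{i+1}] the envelope is the tangent at xi_i.  The
integral over that interval of a tangent to f is the length times the value of
the tangent at the midpoint m, and among all tangents to f the one at m is the
highest at m.  Hence moving xi_i to m increases the area, and a maximal grid
satisfies 2 xi_i = tau_i + tau_{i+1} ([optimal_grid_stationary]).

Uniqueness.  The abscissa tau_i is the centroid c(xi_{i-1}, xi_i) of the
measure f''(t) dt on [xi_{i-1}, xi_i], so that the stationary grids are those of
the quantization problem for the density f'', and uniqueness holds because this
density is log-concave.  Log-concavity enters through the inequality
c(a + h, b + h) <= c(a, b) + h for h >= 0 ([centroid_shift]).  Together with the
monotonicity of c it implies that, when x and y are stationary grids with
x_0 = y_0 and x_1 <= y_1, the differences y_i - x_i are nondecreasing in i
([stationary_grid_le]); as they vanish for i = 0 and i = n, they all vanish. *)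

(** * Powers and their tangents *)

Section power.
Context {R : realType}.
Implicit Types p q x y t a b h : R.

Lemma fpowE q x : 0 <= x -> fpow q x = x `^ q.
Proof. by move=> x0; rewrite /fpow ger0_norm. Qed.

(** The derivative of the power, on [0, +oo[ only.  As a multiple of a power it
gives the second derivative as well. *)
Definition dpow q x := q * fpow (q - 1) x.

(** At 0 the difference quotient is |h| ^ (q - 1) up to sign, which tends to 0
since q > 1. *)
Lemma is_derive_fpow q x : 1 < q -> 0 <= x ->
  is_derive x 1 (fpow q) (dpow q x).
Proof.
move=> q1; rewrite le_eqVlt => /predU1P[<-|x0].
  have q0 : 0 < q - 1 by rewrite subr_gt0.
  have lim0 : h^-1 *: (fpow q (h *: (1 : R^o) + 0) - fpow q 0) @[h --> 0^'] -->
      (0 : R).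
    apply/cvgrPdist_lt => e e0.
    have d0 : 0 < e `^ (q - 1)^-1 by rewrite powR_gt0.
    near=> h.
    have h0 : h != 0 by near: h; exact: nbhs_dnbhs_neq.
    have nh0 : `|h| != 0 by rewrite normr_eq0.
    have -> : h^-1 *: (fpow q (h *: (1 : R^o) + 0) - fpow q 0) =
        (h^-1 * `|h|) * `|h| `^ (q - 1).
      rewrite /fpow normr0 powR0 ?gt_eqF ?(lt_trans ltr01)// subr0 addr0.
      by rewrite -mulrA mulr_powRB1 ?(lt_trans ltr01)// /GRing.scale/= mulr1.
    rewrite sub0r normrN !normrM normfV normr_id mulVf// mul1r.
    rewrite ger0_norm ?powR_ge0// -[ltRHS]powRr1 ?ltW//.
    rewrite -[X in e `^ X](mulVf (lt0r_neq0 q0)) powRrM.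
    apply: gt0_ltr_powR; rewrite ?nnegrE ?powR_ge0//.
    by near: h; exact: dnbhs0_lt.
  have -> : dpow q 0 = 0.
    by rewrite /dpow fpowE// powR0 ?gt_eqF// mulr0.
  split; last by apply/cvg_lim => //; exact: lim0.
  by apply/cvg_ex; exists 0; exact: lim0.
have xin : x \in `]0, +oo[ by rewrite in_itv/= x0.
have xE : {near x, @powR R ^~ q =1 fpow q}.
  by near=> z; rewrite fpowE//; apply: ltW; near: z; exact: lt_nbhsr.
split.
  by apply: near_eq_derivable xE _; exact: derivable_powR.
rewrite -(@near_eq_derive _ R^o R^o _ _ _ _ xE).
by rewrite -derive1E (powR_derive1 _ xin) /dpow fpowE// ltW.
Unshelve. all: by end_near. Qed.

Lemma derive1_fpow q x : 1 < q -> 0 <= x -> (fpow q)^`()%classic x = dpow q x.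
Proof.
by move=> q1 x0; have := is_derive_fpow q1 x0; rewrite derive1E => -[].
Qed.

Lemma continuous_fpow q x : 1 < q -> 0 <= x -> {for x, continuous (fpow q)}.
Proof.
move=> q1 x0; apply: differentiable_continuous; apply/derivable1_diffP.
by have [] := is_derive_fpow q1 x0.
Qed.

Lemma ltr_fpow q x y : 0 < q -> 0 <= x -> x < y -> fpow q x < fpow q y.
Proof.
move=> q0 x0 xy; have y0 := ltW (le_lt_trans x0 xy).
by rewrite !fpowE// gt0_ltr_powR// nnegrE.
Qed.

Lemma ltr_dpow q x y : 1 < q -> 0 <= x -> x < y -> dpow q x < dpow q y.
Proof.
move=> q1 x0 xy; rewrite /dpow ltr_pM2l ?(lt_trans ltr01)//.
by apply: ltr_fpow; rewrite ?subr_gt0.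
Qed.

Lemma dpow_ge0 q x : 0 <= q -> 0 <= dpow q x.
Proof. by move=> q0; rewrite mulr_ge0// powR_ge0. Qed.

Lemma fpow_MVT q x y : 1 < q -> 0 <= x -> x < y ->
  exists2 c, x < c < y & fpow q y - fpow q x = dpow q c * (y - x).
Proof.
move=> q1 x0 xy.
have [|||c cxy e] := @MVT _ (fpow q) (dpow q) x y.
- by [].
- move=> z; rewrite in_itv/= => /andP[xz _].
  by apply: is_derive_fpow; rewrite // (le_trans x0)// ltW.
- apply: continuous_in_subspaceT => z; rewrite inE/= in_itv/= => /andP[xz _].
  by apply: continuous_fpow => //; exact: le_trans xz.
- by exists c.
Qed.

Definition tangent q x t := fpow q x + dpow q x * (t - x).

Lemma tangent_lt_fpow q x t : 1 < q -> 0 <= x -> 0 <= t -> x != t ->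
  tangent q x t < fpow q t.
Proof.
move=> q1 x0 t0; rewrite /tangent -ltrBrDl neq_lt => /orP[] xt.
  have [c /andP[xc ct] ->] := fpow_MVT q1 x0 xt.
  by rewrite ltr_pM2r ?subr_gt0// ltr_dpow.
have [c /andP[xc ct] e] := fpow_MVT q1 t0 xt.
rewrite -ltrN2 opprB e -mulrN opprB ltr_pM2r ?subr_gt0// ltr_dpow//.
by rewrite (le_trans t0)// ltW.
Qed.

Lemma tangentxx q x : tangent q x x = fpow q x.
Proof. by rewrite /tangent subrr mulr0 addr0. Qed.

Lemma tangent_le_fpow q x t : 1 < q -> 0 <= x -> 0 <= t ->
  tangent q x t <= fpow q t.
Proof.
move=> q1 x0 t0; have [->|xt] := eqVneq x t; first by rewrite tangentxx.
by rewrite ltW// tangent_lt_fpow.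
Qed.

(** The tangent at [x] meets the vertical axis at [- intercept q x].  The
derivative of [intercept q] at [t] is [t] times the second derivative of the
power. *)
Definition intercept q x := dpow q x * x - fpow q x.

Lemma tangentE q x t : tangent q x t = dpow q x * t - intercept q x.
Proof. by rewrite /tangent /intercept; ring. Qed.

(** By [tangent_centroid] this is the abscissa where the tangents at [a] and [b]
meet.  The numerator is the integral over [a, b] of [t f''(t)] and the
denominator that of [f''(t)], so it is also the centroid of the interval for the
density [f'']. *)
Definition centroid q a b :=
  (intercept q b - intercept q a) / (dpow q b - dpow q a).

Lemma tangentB q a b t : 1 < q -> 0 <= a -> a < b ->
  tangent q b t - tangent q a t =
  (dpow q b - dpow q a) * (t - centroid q a b).
Proof.
move=> q1 a0 ab; rewrite !tangentE /centroid mulrBr mulrCA divff; first by ring.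
by rewrite subr_eq0 gt_eqF// ltr_dpow.
Qed.

Lemma tangent_centroid q a b : 1 < q -> 0 <= a -> a < b ->
  tangent q b (centroid q a b) = tangent q a (centroid q a b).
Proof.
by move=> q1 a0 ab; apply/eqP; rewrite -subr_eq0 tangentB// subrr mulr0.
Qed.

Lemma le_tangent_centroid q a b t : 1 < q -> 0 <= a -> a < b ->
  (tangent q a t <= tangent q b t) = (centroid q a b <= t).
Proof.
move=> q1 a0 ab; rewrite -subr_ge0 tangentB// pmulr_rge0 ?subr_ge0//.
by rewrite subr_gt0 ltr_dpow.
Qed.

Lemma lt_centroid q a b : 1 < q -> 0 <= a -> a < b -> a < centroid q a b.
Proof.
move=> q1 a0 ab; rewrite ltNge -le_tangent_centroid// -ltNge tangentxx.
by rewrite tangent_lt_fpow// ?(le_trans a0 (ltW ab))// gt_eqF.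
Qed.

Lemma centroid_lt q a b : 1 < q -> 0 <= a -> a < b -> centroid q a b < b.
Proof.
move=> q1 a0 ab; have b0 := le_trans a0 (ltW ab).
rewrite -subr_gt0 -(pmulr_rgt0 _ (_ : 0 < dpow q b - dpow q a)).
  by rewrite -tangentB// tangentxx subr_gt0 tangent_lt_fpow// lt_eqF.
by rewrite subr_gt0 ltr_dpow.
Qed.

(** The integrals of [t f''(t)] and [f''(t)] are additive in the interval, hence
the centroid of [a, c] is a weighted mean of those of [a, b] and [b, c].  This
yields strict monotonicity in both end points. *)
Lemma centroid_split q a b c : 1 < q -> 0 <= a -> a < b -> b < c ->
  (dpow q c - dpow q a) * centroid q a c =
  (dpow q b - dpow q a) * centroid q a b +
  (dpow q c - dpow q b) * centroid q b c.
Proof.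
move=> q1 a0 ab bc; have b0 := le_trans a0 (ltW ab).
have := ltr_dpow q1 a0 ab; have := ltr_dpow q1 b0 bc => cb ba.
rewrite /centroid !(mulrC _ (_ / _)) !divfK; first by ring.
- by rewrite gt_eqF// subr_gt0.
- by rewrite gt_eqF// subr_gt0.
- by rewrite gt_eqF// subr_gt0 (lt_trans ba).
Qed.

Lemma centroid_ltr q a b b' : 1 < q -> 0 <= a -> a < b -> b < b' ->
  centroid q a b < centroid q a b'.
Proof.
move=> q1 a0 ab bb'; have b0 := le_trans a0 (ltW ab).
have ba := ltr_dpow q1 a0 ab; have b'b := ltr_dpow q1 b0 bb'.
rewrite -subr_gt0 -(pmulr_rgt0 _ (_ : 0 < dpow q b' - dpow q a)); last first.
  by rewrite subr_gt0 (lt_trans ba).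
rewrite mulrBr (centroid_split q1 a0 ab bb').
have -> : forall u v x y z : R, (v - u) * x + (z - v) * y - (z - u) * x =
  (z - v) * (y - x) by move=> *; ring.
rewrite mulr_gt0 ?subr_gt0// (lt_trans (centroid_lt q1 a0 ab))//.
exact: lt_centroid.
Qed.

Lemma centroid_ltl q a a' b : 1 < q -> 0 <= a -> a < a' -> a' < b ->
  centroid q a b < centroid q a' b.
Proof.
move=> q1 a0 aa' a'b; have a'0 := le_trans a0 (ltW aa').
have a'a := ltr_dpow q1 a0 aa'; have ba' := ltr_dpow q1 a'0 a'b.
rewrite -subr_gt0 -(pmulr_rgt0 _ (_ : 0 < dpow q b - dpow q a)); last first.
  by rewrite subr_gt0 (lt_trans a'a).
rewrite mulrBr (centroid_split q1 a0 aa' a'b).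
have -> : forall u v x y z : R, (z - u) * y - ((v - u) * x + (z - v) * y) =
  (v - u) * (y - x) by move=> *; ring.
rewrite mulr_gt0 ?subr_gt0// (lt_trans (centroid_lt q1 a0 aa'))//.
exact: lt_centroid.
Qed.

Lemma centroid_le q a b a' b' : 1 < q -> 0 <= a -> a < b -> a' < b' ->
  a <= a' -> b <= b' -> centroid q a b <= centroid q a' b'.
Proof.
move=> q1 a0 ab ab'; rewrite le_eqVlt => /predU1P[<-|aa'].
  by rewrite le_eqVlt => /predU1P[<-//|bb']; exact/ltW/centroid_ltr.
move=> bb'; apply: (@le_trans _ _ (centroid q a b')).
  by move: bb'; rewrite le_eqVlt => /predU1P[<-//|bb']; exact/ltW/centroid_ltr.
exact/ltW/centroid_ltl.
Qed.

Lemma is_derive_dpow q x : 2 < q -> 0 <= x ->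
  is_derive x 1 (dpow q) (q * dpow (q - 1) x).
Proof.
move=> q2 x0.
have q1 : 1 < q - 1 by rewrite ltrBrDr.
have h := is_derive_fpow q1 x0.
by rewrite /dpow; apply: is_deriveZ.
Qed.

Lemma continuous_dpow q x : 2 < q -> 0 <= x -> {for x, continuous (dpow q)}.
Proof.
move=> q2 x0; apply: differentiable_continuous; apply/derivable1_diffP.
by have [] := is_derive_dpow q2 x0.
Qed.

(** Log-concavity of t ^ (q - 2), with denominators cleared: the ratio
[dpow (q - 1) (x + h) / dpow (q - 1) x] is nonincreasing in [x].  It comes down
to (x + h) a - (a + h) x = h (a - x). *)
Lemma dpow_shift q a h x : 2 < q -> 0 <= a -> 0 <= h -> 0 <= x ->
  (x - a) * (dpow (q - 1) (x + h) * dpow (q - 1) a)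
  <= (x - a) * (dpow (q - 1) (a + h) * dpow (q - 1) x).
Proof.
move=> q2 a0 h0 x0.
have q2' : 0 <= q - 1 - 1 by lra.
have xh := addr_ge0 x0 h0; have ah := addr_ge0 a0 h0.
have E (v w : R) : 0 <= v -> 0 <= w -> dpow (q - 1) v * dpow (q - 1) w =
    (q - 1) ^+ 2 * (v * w) `^ (q - 1 - 1).
  by move=> v0 w0; rewrite /dpow !fpowE// powRM// expr2 mulrACA.
rewrite -subr_ge0 -mulrBr !E// -mulrBr mulrCA mulr_ge0 ?sqr_ge0//.
have key (u v : R) : 0 <= u -> 0 <= v -> u <= v ->
    u `^ (q - 1 - 1) <= v `^ (q - 1 - 1).
  by move=> u0 v0; apply: ge0_ler_powR; rewrite ?nnegrE.
have [xa|ax] := leP a x.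
  by rewrite mulr_ge0 ?subr_ge0// key ?mulr_ge0//; nra.
rewrite nmulr_rge0 ?subr_lt0// subr_le0 key ?mulr_ge0//; nra.
Qed.

(** Translating the interval by [h] amounts to replacing the density [f''] by
its translate, that is, to multiplying it by the nonincreasing function
[f''(t + h) / f''(t)]; this can only move the centroid to the left. *)
Lemma centroid_shift q a b h : 2 < q -> 0 <= a -> a < b -> 0 <= h ->
  centroid q (a + h) (b + h) <= centroid q a b + h.
Proof.
move=> q2 a0 ab h0.
have q1 : 1 < q by lra.
have b0 := le_trans a0 (ltW ab).
have ah0 := addr_ge0 a0 h0.
have abh : a + h < b + h by rewrite ltrD2r.
have dh := ltr_dpow q1 ah0 abh.
have d0 := ltr_dpow q1 a0 ab.
set c := centroid q a b.
have ac : a < c := lt_centroid q1 a0 ab.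
have c0 := le_lt_trans a0 ac.
set A := dpow (q - 1) c; set B := dpow (q - 1) (c + h).
have A0 : 0 < A.
  by rewrite /A /dpow fpowE ?(ltW c0)// mulr_gt0 ?powR_gt0//; lra.
have shift x : 0 <= x -> (x - c) * (dpow (q - 1) (x + h) * A) <=
    (x - c) * (B * dpow (q - 1) x).
  exact: dpow_shift (ltW c0) h0.
clearbody A B.
(* With A and B proportional to f''(c) and f''(c + h), the derivative of F at x
   is (x - c) (A f''(x + h) - B f''(x)), which log-concavity makes nonpositive
   on both sides of c. *)
pose F x := A * ((x - c) * dpow q (x + h) - fpow q (x + h))
          - B * ((x - c) * dpow q x - fpow q x).
pose G x := q * (A * ((x - c) * dpow (q - 1) (x + h))
          - B * ((x - c) * dpow (q - 1) x)).
have dF x : 0 <= x -> is_derive x 1 F (G x).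
  move=> x0; have xh := addr_ge0 x0 h0.
  have d1 := is_derive_dpow q2 x0; have d2 := is_derive_fpow q1 x0.
  have sh : is_derive x 1 (fun y : R => y + h) 1.
    by rewrite -[X in is_derive _ _ _ X]addr0; apply: is_deriveD.
  have d3 : is_derive x 1 (fun y => dpow q (y + h)) (q * dpow (q - 1) (x + h)).
    have := is_derive_dpow q2 xh.
    by move=> ?; rewrite -[X in is_derive _ _ _ X]mulr1; apply: is_derive1_comp.
  have d4 : is_derive x 1 (fun y => fpow q (y + h)) (dpow q (x + h)).
    have := is_derive_fpow q1 xh.
    by move=> ?; rewrite -[X in is_derive _ _ _ X]mulr1; apply: is_derive1_comp.
  rewrite /F; apply: is_derive_eq; rewrite /G /GRing.scale/=; ring.
have Fba : F b <= F a.
  have cF x : 0 <= x -> {for x, continuous F}.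
    move=> x0; apply: differentiable_continuous; apply/derivable1_diffP.
    by have [] := dF _ x0.
  apply: (@ler0_derive1_le_cc _ F a b).
  - move=> x; rewrite in_itv/= => /andP[ax _].
    by have [] := dF x (le_trans a0 (ltW ax)).
  - move=> x; rewrite in_itv/= => /andP[ax _].
    have x0 := le_trans a0 (ltW ax).
    rewrite derive1E; have [_ ->] := dF x x0.
    rewrite /G pmulr_rle0; last by lra.
    by have := shift x x0; lra.
  - apply: continuous_in_subspaceT => x; rewrite inE/= in_itv/= => /andP[ax _].
    exact/cF/(le_trans a0).
  - by rewrite in_itv/= lexx ltW.
  - by rewrite in_itv/= lexx ltW.
  - exact: ltW.
have := tangent_centroid q1 a0 ab; rewrite -/c => Tc.
have E1 x : (x - c) * dpow q (x + h) - fpow q (x + h) =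
  - tangent q (x + h) (c + h) by rewrite /tangent; ring.
have E2 x : (x - c) * dpow q x - fpow q x = - tangent q x c.
  by rewrite /tangent; ring.
by move: Fba; rewrite /F !E1 !E2 Tc lerD2r ler_pM2l// lerN2 le_tangent_centroid.
Qed.

End power.

(** * Upper envelopes of tangents and the area under them *)

Section envelope.
Context {R : realType}.
Implicit Types q c x y t a b : R.
Implicit Types s : seq R.
Local Notation mu := (@lebesgue_measure R).

(** One tangent, at [c], is singled out so that the family is never empty. *)
Definition envelope q c s t :=
  \big[Num.max/tangent q c t]_(x <- s) tangent q x t.

Lemma envelope_leP q c s t b :
  reflect (forall x, x \in c :: s -> tangent q x t <= b)
    (envelope q c s t <= b).
Proof.
apply: (iffP idP).
  rewrite /envelope; elim: s => [|y s IH].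
    by rewrite big_nil => h x; rewrite inE => /eqP ->.
  rewrite big_cons ge_max => /andP[yb /IH{}IH] x.
  rewrite !inE => /or3P[/eqP->|/eqP->//|xs]; apply: IH.
    by rewrite mem_head.
  by rewrite inE xs orbT.
move=> h; rewrite /envelope big_seq; elim/big_ind: _ => [|x y xb yb|x xs].
- by apply: h; rewrite mem_head.
- by rewrite ge_max xb.
- by apply: h; rewrite inE xs orbT.
Qed.

Lemma tangent_le_envelope q c s x t : x \in c :: s ->
  tangent q x t <= envelope q c s t.
Proof. by move=> xs; have /envelope_leP := lexx (envelope q c s t); apply. Qed.

Lemma envelope_subset q c s c' s' t : {subset c :: s <= c' :: s'} ->
  envelope q c s t <= envelope q c' s' t.
Proof.
by move=> ss'; apply/envelope_leP => x /ss'; exact: tangent_le_envelope.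
Qed.

Lemma envelope_attained q c s t :
  exists2 x, x \in c :: s & envelope q c s t = tangent q x t.
Proof.
rewrite /envelope; elim: s => [|y s [x xs ex]].
  by exists c; rewrite ?mem_head// big_nil.
rewrite big_cons ex maxEge; case: ifP => _.
  by exists y => //; rewrite !inE eqxx orbT.
exists x => //; move: xs; rewrite !inE => /orP[->//|->].
by rewrite !orbT.
Qed.

Lemma envelope_lt_fpow q c s t : 1 < q -> {in c :: s, forall x, 0 <= x} ->
  0 <= t -> t \notin c :: s -> envelope q c s t < fpow q t.
Proof.
move=> q1 s0 t0 ts; have [x xs ->] := envelope_attained q c s t.
apply: tangent_lt_fpow => //; first exact: s0.
by apply: contraNneq ts => <-.
Qed.

Lemma continuous_tangent q x : continuous (tangent q x).
Proof.
move=> t; rewrite /tangent; apply: cvgD; first exact: cvg_cst.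
by apply: cvgM; [exact: cvg_cst|apply: cvgB; [exact: cvg_id|exact: cvg_cst]].
Qed.

Lemma continuous_envelope q c s : continuous (envelope q c s).
Proof.
rewrite /envelope; elim: s => [|y s IH] t.
  by under eq_fun do rewrite big_nil; exact: continuous_tangent.
under eq_fun do rewrite big_cons.
by apply: continuous_max; [exact: continuous_tangent|exact: IH].
Qed.

Lemma dist_max a b x y :
  `|Num.max a x - Num.max b y| <= `|a - b| + `|x - y|.
Proof.
rewrite !maxEle; do 2 case: ifP => ?; rewrite ler_norml;
  by do 2 case: ger0P => ?; lra.
Qed.

Lemma dist_envelope (I : Type) (r : seq I) (f g : I -> R) q c t b :
  0 <= t <= b ->
  `|envelope q c (map f r) t - envelope q c (map g r) t| <=
  \sum_(i <- r) (b * `|dpow q (f i) - dpow q (g i)| +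
                 `|intercept q (f i) - intercept q (g i)|).
Proof.
move=> /andP[t0 tb]; rewrite /envelope; elim: r => [|i r IH].
  by rewrite !big_nil subrr normr0.
rewrite /= !big_cons (le_trans (dist_max _ _ _ _))// lerD//.
have -> : tangent q (f i) t - tangent q (g i) t =
    t * (dpow q (f i) - dpow q (g i)) - (intercept q (f i) - intercept q (g i)).
  by rewrite !tangentE; ring.
rewrite (le_trans (ler_normB _ _))// lerD2r normrM.
by rewrite ler_wpM2r// ger0_norm.
Qed.

Lemma integrable_continuous (f : R -> R) a b : continuous f ->
  mu.-integrable `[a, b] (EFin \o f).
Proof.
move=> cf; apply: continuous_compact_integrable; first exact: segment_compact.
exact: continuous_subspaceT.
Qed.

Lemma integrable_envelope q c s a b :
  mu.-integrable `[a, b] (EFin \o envelope q c s).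
Proof. exact/integrable_continuous/continuous_envelope. Qed.

Lemma Rintegral_affine (A B a b : R) : a < b ->
  \int[mu]_(t in `[a, b]) (A * t + B) = (b - a) * (A * ((a + b) / 2) + B).
Proof.
move=> ab.
pose F (t : R) := A / 2 * t ^+ 2 + B * t.
have dF (t : R) : is_derive t 1 F (A * t + B).
  rewrite /F; apply: is_derive_eq.
  by rewrite /GRing.scale/=; field.
have cF : continuous F.
  move=> t; apply: differentiable_continuous; apply/derivable1_diffP.
  by have [] := dF t.
rewrite /Rintegral (@continuous_FTC2 _ (fun t => A * t + B) F)//=.
- by rewrite /F; field.
- apply: continuous_subspaceT => t; apply: cvgD; last exact: cvg_cst.
  by apply: cvgM; [exact: cvg_cst|exact: cvg_id].
- split.
  + by move=> t _; have [] := dF t.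
  + by apply: cvg_at_right_filter; exact: cF.
  + by apply: cvg_at_left_filter; exact: cF.
- by move=> t _; rewrite derive1E; have [_ ->] := dF t.
Qed.

(** Tangents at both end points are always present, and [s] may list the other
points in any order and with repetitions. *)
Definition under_area q l u s :=
  \int[mu]_(t in `[l, u]) envelope q l (u :: s) t.

(** The integral of [k] is that of its extension by 0, which [h] dominates on
the whole interval. *)
Lemma le_Rintegral_subitv (h k : R -> R) a b m1 m2 :
  continuous h -> continuous k -> a <= m1 -> m2 <= b ->
  (forall x, m1 <= x <= m2 -> k x <= h x) ->
  (forall x, a <= x <= b -> ~~ (m1 <= x <= m2) -> 0 <= h x) ->
  \int[mu]_(t in `[m1, m2]) k t <= \int[mu]_(t in `[a, b]) h t.
Proof.
move=> ch ck am1 m2b kh h0.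
have sub : `[m1, m2] `<=` `[a, b].
  move=> x /=; rewrite !in_itv/= => /andP[/(le_trans am1) -> xm2].
  exact: le_trans m2b.
rewrite -(setIidr sub) Rintegral_mkcondr; apply: le_Rintegral => //.
- rewrite -restrict_EFin; apply/integrable_restrict => //.
  by rewrite setIidr//; exact: integrable_continuous.
- exact: integrable_continuous.
- move=> x /=; rewrite in_itv/= => xab; rewrite patchE; case: ifPn.
    by rewrite inE/= in_itv/=; exact: kh.
  by move=> xm; apply: h0 => //; apply: contra xm; rewrite inE/= in_itv.
Qed.

Lemma lt_Rintegral_continuous (f g : R -> R) a b m :
  continuous f -> continuous g -> a < m < b ->
  (forall x, a <= x <= b -> f x <= g x) -> f m < g m ->
  \int[mu]_(t in `[a, b]) f t < \int[mu]_(t in `[a, b]) g t.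
Proof.
move=> cf cg /andP[am mb] fg fgm.
have cgf : continuous (g \- f) by move=> x; apply: cvgB; [exact: cg|exact: cf].
rewrite -subr_gt0 -RintegralB//; try exact: integrable_continuous.
pose e := (g m - f m) / 2.
have e0 : 0 < e by rewrite divr_gt0// subr_gt0.
have /cvgrPdist_lt/(_ e e0) := cgf m.
move=> /nbhs_ballP[d /= d0 dP].
pose m2 := Num.min b (m + d / 2).
have mm2 : m < m2 by rewrite lt_min mb ltrDl divr_gt0.
apply: (@lt_le_trans _ _ (\int[mu]_(t in `[m, m2]) e)).
  rewrite Rintegral_cst//= lebesgue_measure_itv/= lte_fin mm2/=.
  by rewrite mulr_gt0// subr_gt0.
apply: (@le_Rintegral_subitv (g \- f) (fun=> e)) => //.
- by move=> x; exact: cvg_cst.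
- exact: ltW.
- by rewrite /m2 ge_min lexx.
- move=> x /andP[mx xm2].
  have xmd : `|m - x| < d.
    rewrite distrC ger0_norm ?subr_ge0//.
    have : m2 <= m + d / 2 by rewrite /m2 ge_min lexx orbT.
    lra.
  by have := dP x xmd; rewrite /= /e => /ltr_normlP[]; lra.
- by move=> x xab _; rewrite /= subr_ge0 fg.
Qed.

Lemma dist_under_area (I : Type) (r : seq I) (f g : I -> R) q l u :
  0 <= l -> l <= u ->
  `|under_area q l u (map f r) - under_area q l u (map g r)| <=
  (u - l) * \sum_(i <- r) (u * `|dpow q (f i) - dpow q (g i)| +
                 `|intercept q (f i) - intercept q (g i)|).
Proof.
move=> l0 lu; rewrite /under_area -RintegralB//; try exact: integrable_envelope.
set D := \sum_(i <- r) _.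
have iB : mu.-integrable `[l, u] (EFin \o (fun t =>
    envelope q l (u :: map f r) t - envelope q l (u :: map g r) t)).
  apply: integrable_continuous => t.
  by apply: cvgB; exact: continuous_envelope.
apply: (le_trans (le_normr_Rintegral _ iB)) => //.
have <- : \int[mu]_(t in `[l, u]) D = (u - l) * D.
  rewrite Rintegral_cst//= lebesgue_measure_itv/= lte_fin.
  case: ltgtP lu => // [_|->] _; last by rewrite subrr mulr0 mul0r.
  by rewrite /= mulrC.
apply: le_Rintegral => //.
- apply: integrable_continuous => t; apply: cvg_norm.
  by apply: cvgB; exact: continuous_envelope.
- by apply: integrable_continuous => t; exact: cvg_cst.
- move=> t /=; rewrite in_itv/= => /andP[lt tu].
  rewrite /envelope !big_cons (le_trans (dist_max _ _ _ _))//.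
  rewrite subrr normr0 add0r.
  by apply: dist_envelope; rewrite (le_trans l0 lt) tu.
Qed.

Lemma continuous_intercept q x : 2 < q -> 0 <= x ->
  {for x, continuous (intercept q)}.
Proof.
move=> q2 x0; rewrite /intercept; apply: cvgB.
  by apply: cvgM; [exact: continuous_dpow|exact: cvg_id].
by apply: continuous_fpow => //; rewrite (lt_trans _ q2)// ltr1n.
Qed.

(** The tangent at [x] depends on [x] through its slope and its intercept only,
so the area varies by at most a multiple of their variations. *)
Lemma continuous_under_area n q l u (v : 'rV[R]_n) :
  2 < q -> 0 <= l -> l <= u ->
  (forall i, 0 <= v ord0 i) ->
  {for v, continuous
    (fun w : 'rV[R]_n => under_area q l u [seq w ord0 i | i <- enum 'I_n])}.
Proof.
move=> q2 l0 lu v0.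
pose D (w : 'I_n -> R) := (u - l) * \sum_(i <- enum 'I_n)
  (u * `|dpow q (v ord0 i) - dpow q (w i)| +
   `|intercept q (v ord0 i) - intercept q (w i)|).
have cD (T : Type) (F : set_system T) (FF : Filter F) (g : T -> 'I_n -> R) :
    (forall i, g w i @[w --> F] --> v ord0 i) ->
    D (g w) @[w --> F] --> D (v ord0).
  move=> gv; rewrite /D; apply: cvgM; first exact: cvg_cst.
  apply: (@cvg_big R _ +%R 0 xpredT) => [|i _]; first exact: add_continuous.
  apply: cvgD.
    apply: cvgM; first exact: cvg_cst.
    apply: cvg_norm; apply: cvgB; first exact: cvg_cst.
    apply: (cvg_comp _ _ (gv i)); exact: continuous_dpow.
  apply: cvg_norm; apply: cvgB; first exact: cvg_cst.
  by apply: (cvg_comp _ _ (gv i)); exact: continuous_intercept.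
have Dv : D (v ord0) = 0.
  by rewrite /D big1 ?mulr0// => i _; rewrite !subrr normr0 mulr0 addr0.
have {}cD := cD _ _ (nbhs_filter v) (fun w => w ord0)
  (fun i => @coord_continuous _ _ _ ord0 i v).
move: cD; rewrite Dv => /cvgrPdist_lt cD.
apply/(@cvgrPdist_lt _ _ _ _ (nbhs_filter v)) => e e0.
apply: (@filterS _ _ (nbhs_filter v) _ _ _ (cD e e0)) => w Dw.
apply: (le_lt_trans (dist_under_area _ _ _ _ l0 lu)).
rewrite -/(D (w ord0)) (le_lt_trans (ler_norm _))// -normrN -sub0r.
exact: Dw.
Qed.

Lemma exists_max_under_area n q l u : 2 < q -> 0 <= l -> l <= u ->
  exists s : seq R, [/\ size s = n, {in s, forall x, l <= x <= u} &
    forall s', size s' = n -> {in s', forall x, l <= x <= u} ->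
      under_area q l u s' <= under_area q l u s].
Proof.
move=> q2 l0 lu.
pose A := [set v : 'rV[R]_n | forall i, `[l, u]%classic (v ord0 i)].
have A0 : A !=set0.
  by exists (\row__ l) => i; rewrite /= mxE in_itv/= lexx.
have cA : compact A.
  apply: (@rV_compact R n (fun=> `[l, u]%classic)) => _.
  exact: segment_compact.
have [|v vA vmax] := @EVT_max_rV R n (fun w : 'rV[R]_n =>
   under_area q l u [seq w ord0 i | i <- enum 'I_n]) A A0 cA.
  apply: continuous_in_subspaceT => v; rewrite inE => vA.
  apply: continuous_under_area => // i.
  by have := vA i; rewrite /= in_itv/= => /andP[/(le_trans l0)].
move: vA; rewrite inE => vA.
exists [seq v ord0 i | i <- enum 'I_n]; split.
- by rewrite size_map size_enum_ord.
- by move=> _ /mapP[i _ ->]; have := vA i; rewrite /= in_itv.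
- move=> s' sz s'lu.
  have := vmax (\row_i s'`_i); rewrite inE.
  have -> : [seq (\row_i0 s'`_i0) ord0 i | i <- enum 'I_n] = s'.
    apply: (@eq_from_nth _ 0); rewrite size_map size_enum_ord// => i ilt.
    by rewrite (nth_map (Ordinal ilt)) ?size_enum_ord// mxE nth_enum_ord.
  apply => i; rewrite /= mxE in_itv/=; apply: s'lu; apply: mem_nth.
  by rewrite sz.
Qed.

End envelope.

(** * The piecewise-linear function of a strict grid *)

Section grid.
Context {R : realType}.
Implicit Types q c x y t a b : R.
Implicit Types s : seq R.
Local Notation mu := (@lebesgue_measure R).

Lemma pwlin_segment (X Y : nat -> R) k m t : (0 < m)%N ->
  X k <= t <= X (k + m)%N ->
  exists j, [/\ (k <= j < k + m)%N, X j <= t <= X j.+1 &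
    pwlin (X k, Y k) [seq (X i, Y i) | i <- iota k.+1 m] t =
    Y j + (Y j.+1 - Y j) / (X j.+1 - X j) * (t - X j)].
Proof.
elim: m k => // m IH k _ /andP[kt tk] /=.
have [tk1|k1t] := leP t (X k.+1).
  by exists k; rewrite leqnn kt tk1 addnS ltnS leq_addr.
case: m IH tk => [|m] IH tk.
  by move: tk; rewrite addn1 leNgt k1t.
have [//||j [/andP[kj jk] tj ->]] := IH k.+1.
  by rewrite (ltW k1t)/= addSnnS.
by exists j; rewrite (ltnW kj) tj -addSnnS jk.
Qed.

Lemma eq_envelope q c s c' s' : c :: s =i c' :: s' ->
  envelope q c s = envelope q c' s'.
Proof.
move=> ss'; apply/funext => t; apply/eqP; rewrite eq_le.
by rewrite !envelope_subset// => x; rewrite ss'.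
Qed.

Context (p l u : R) (n : nat) (xi : n.+1.-tuple R).
Hypotheses (p1 : 1 < p) (l0 : 0 <= l) (n0 : (0 < n)%N).
Hypothesis grid : strict_grid l u xi.

Lemma grid_lt i j : (i < j)%N -> (j <= n)%N -> xi`_i < xi`_j.
Proof.
have [_ _ xilt] := grid.
elim: j => // j IH; rewrite ltnS leq_eqVlt => /predU1P[->|ij] jn.
  exact: xilt.
by rewrite (lt_trans (IH ij (ltnW jn)))// xilt.
Qed.

Lemma grid_le i j : (i <= j)%N -> (j <= n)%N -> xi`_i <= xi`_j.
Proof.
by rewrite leq_eqVlt => /predU1P[->//|ij] jn; exact/ltW/grid_lt.
Qed.

Lemma grid_itv i : (i <= n)%N -> l <= xi`_i <= u.
Proof.
have [<- <- _] := grid => iin.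
by rewrite !grid_le.
Qed.

Lemma grid_ge0 i : (i <= n)%N -> 0 <= xi`_i.
Proof. by move=> /grid_itv/andP[/(le_trans l0)]. Qed.

Lemma tauS i : (i < n)%N -> tau p l u xi i.+1 = centroid p xi`_i xi`_i.+1.
Proof.
move=> iin; rewrite /tau/= eqSS ltn_eqF//.
rewrite !derive1_fpow ?grid_ge0//; last exact: ltnW.
rewrite /centroid /intercept -mulrNN -invrN; congr (_ * _^-1); ring.
Qed.

Lemma lt_tauS i : (i < n)%N -> xi`_i < tau p l u xi i.+1.
Proof.
by move=> iin; rewrite tauS// lt_centroid ?grid_ge0 ?grid_lt// ltnW.
Qed.

Lemma tauS_lt i : (i < n)%N -> tau p l u xi i.+1 < xi`_i.+1.
Proof.
by move=> iin; rewrite tauS// centroid_lt ?grid_ge0 ?grid_lt// ltnW.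
Qed.

Lemma tau0 : tau p l u xi 0 = xi`_0. Proof. by have [-> _ _] := grid. Qed.

Lemma tau_last : tau p l u xi n.+1 = xi`_n.
Proof. by have [_ -> _] := grid; rewrite /tau/= eqxx. Qed.

Local Opaque tau.

Lemma le_tau j : (j <= n)%N -> xi`_j <= tau p l u xi j.+1.
Proof.
rewrite leq_eqVlt => /predU1P[->|jn]; first by rewrite tau_last.
exact/ltW/lt_tauS.
Qed.

Lemma tau_ltS j : (j <= n)%N -> tau p l u xi j < tau p l u xi j.+1.
Proof.
case: j => [|j] jn; first by rewrite tau0 lt_tauS.
by rewrite (lt_le_trans (tauS_lt jn))// le_tau.
Qed.

Lemma tau_homo i j : (i <= j)%N -> (j <= n.+1)%N ->
  tau p l u xi i <= tau p l u xi j.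
Proof.
elim: j => [|j IH]; first by rewrite leqn0 => /eqP->.
rewrite leq_eqVlt => /predU1P[->//|ij] jn.
by rewrite (le_trans (IH ij (ltnW jn)))// ltW// tau_ltS.
Qed.

Lemma le_tangent_gridS i t : (i < n)%N ->
  (tangent p xi`_i t <= tangent p xi`_i.+1 t) = (tau p l u xi i.+1 <= t).
Proof.
by move=> iin; rewrite le_tangent_centroid ?grid_ge0 ?grid_lt -?tauS// ltnW.
Qed.

(** The difference of two consecutive tangents is affine, increasing, and
vanishes at the breakpoint between them; the breakpoints being increasing, the
tangents are compared one neighbour at a time. *)
Lemma tangent_grid_max i j t : (i <= n)%N -> (j <= n)%N ->
  tau p l u xi j <= t <= tau p l u xi j.+1 ->
  tangent p xi`_i t <= tangent p xi`_j t.
Proof.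
move=> iin jn /andP[jt tj].
have [ij|/ltnW ji] := leqP i j.
  elim: j ij jn jt {tj} => [|j IH]; first by rewrite leqn0 => /eqP->.
  rewrite leq_eqVlt => /predU1P[->//|ij] jn jt.
  apply: (le_trans (IH _ _ _)) => //; first exact: ltnW.
    by apply: le_trans jt; rewrite ltW// tau_ltS// ltnW.
  by rewrite le_tangent_gridS.
elim: i ji iin => [|i IH]; first by rewrite leqn0 => /eqP->.
rewrite leq_eqVlt => /predU1P[<-//|ji] iin.
apply: le_trans (IH ji (ltnW iin)).
rewrite leNgt; apply/negP => lti.
have := ltW lti; rewrite le_tangent_gridS// => it.
have ti : t = tau p l u xi i.+1.
  by apply/eqP; rewrite eq_le it (le_trans tj)// tau_homo// ltnW.
move: lti; rewrite ti tauS// tangent_centroid ?ltxx ?grid_ge0 ?grid_lt//.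
exact: ltnW.
Qed.

Lemma mem_grid x : x \in l :: u :: xi -> exists2 j, (j <= n)%N & x = xi`_j.
Proof.
have [xil xiu _] := grid; rewrite !inE => /or3P[/eqP->|/eqP->|].
- by exists 0%N.
- by exists n.
- by case/(nthP 0) => i; rewrite size_tuple ltnS => iin <-; exists i.
Qed.

Lemma envelope_grid j t : (j <= n)%N ->
  tau p l u xi j <= t <= tau p l u xi j.+1 ->
  envelope p l (u :: xi) t = tangent p xi`_j t.
Proof.
move=> jn tj; apply/eqP; rewrite eq_le; apply/andP; split.
  by apply/envelope_leP => x /mem_grid[i iin ->]; exact: tangent_grid_max.
by rewrite tangent_le_envelope// !inE mem_nth ?orbT// size_tuple.
Qed.

Lemma eta_left j : (j <= n)%N ->
  Defs.eta p l u xi j = tangent p xi`_j (tau p l u xi j).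
Proof.
case: j => [|j] jn.
  by rewrite tau0 tangentxx /Defs.eta/=; have [-> _ _] := grid.
by rewrite /Defs.eta/= eqSS ltn_eqF// derive1_fpow ?grid_ge0.
Qed.

Lemma eta_right j : (j <= n)%N ->
  Defs.eta p l u xi j.+1 = tangent p xi`_j (tau p l u xi j.+1).
Proof.
rewrite leq_eqVlt => /predU1P[->|jn].
  by rewrite tau_last tangentxx /Defs.eta/= eqxx; have [_ -> _] := grid.
by rewrite eta_left// tauS// tangent_centroid ?grid_ge0 ?grid_lt// ltnW.
Qed.

(** Both end points of the j-th segment of the graph lie on the tangent at the
j-th grid point, since consecutive tangents meet at the breakpoints. *)
Lemma gpl_envelope t : l <= t <= u -> gpl p l u xi t = envelope p l (u :: xi) t.
Proof.
move=> ltu; rewrite /gpl.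
have [||j [jn tj ->]] :=
    @pwlin_segment (tau p l u xi) (Defs.eta p l u xi) 0 n.+1 t.
- by [].
- by rewrite add0n tau0 tau_last; have [-> -> _] := grid.
move: jn; rewrite add0n ltnS /= => jn.
rewrite (envelope_grid jn tj) eta_left// eta_right//.
have := tau_ltS jn; rewrite -subr_gt0 => /lt0r_neq0 d0.
have -> (b a : R) : tangent p xi`_j b - tangent p xi`_j a =
  dpow p xi`_j * (b - a) by rewrite /tangent; ring.
by rewrite mulfK// /tangent; ring.
Qed.

Lemma continuous_tangentB a b :
  continuous (fun t => tangent p a t - tangent p b t).
Proof. by move=> t; apply: cvgB; exact: continuous_tangent. Qed.

(** The new family trades the i-th grid point for the midpoint [m] of its two
breakpoints.  Between the breakpoints the envelope gains at least the difference
of the two tangents, whose integral is the length times the positive value of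
that difference at [m]; elsewhere nothing is lost. *)
Lemma grid_replace_mid i : (0 < i < n)%N ->
  2 * xi`_i != tau p l u xi i + tau p l u xi i.+1 ->
  exists s, [/\ size s = n.-1, {in s, forall x, l <= x <= u} &
    under_area p l u xi < under_area p l u s].
Proof.
move=> /andP[i0 iin] xim.
pose m := (tau p l u xi i + tau p l u xi i.+1) / 2.
have iin' := ltnW iin.
have tlt := tau_ltS iin'.
have tm : tau p l u xi i < m < tau p l u xi i.+1 by rewrite /m; lra.
have [xil xiu _] := grid.
have [x1 x2] : xi`_i.-1 < m /\ m < xi`_i.+1.
  have := tauS_lt iin; have := @lt_tauS i.-1.
  rewrite prednK// => /(_ iin'); lra.
have lm : l < m.
  by rewrite (le_lt_trans _ x1)// -xil grid_le// (leq_trans (leq_pred _)).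
have mu' : m < u by rewrite (lt_le_trans x2)// -xiu grid_le.
exists (m :: [seq xi`_j | j <- rem i (iota 1 n.-1)]); split.
- rewrite /= size_map size_rem ?size_iota ?mem_iota ?i0//=.
    by rewrite prednK// -ltnS prednK// (leq_trans _ iin).
  by rewrite add1n prednK.
- move=> x; rewrite inE => /predU1P[->|/mapP[j + ->]]; first by rewrite !ltW.
  rewrite mem_rem_uniq ?iota_uniq// inE mem_iota add1n prednK//.
  by move=> /and3P[_ _ /ltnW/grid_itv].
set s := m :: _.
have m0 : 0 <= m by rewrite (le_trans l0)// ltW.
have xim0 : xi`_i != m.
  by apply: contra_neq xim => ->; rewrite /m; field.
have s_in j : (j <= n)%N -> j != i -> xi`_j \in l :: u :: s.
  move=> jn ji; rewrite !inE -xil -xiu.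
  have [->|j0] := posnP j; first by rewrite eqxx.
  move: jn; rewrite leq_eqVlt => /predU1P[->|jn]; first by rewrite eqxx orbT.
  do 3 (apply/orP; right); apply/mapP; exists j => //.
  by rewrite mem_rem_uniq ?iota_uniq// inE ji mem_iota j0 add1n prednK.
rewrite /under_area -subr_gt0 -RintegralB//; try exact: integrable_envelope.
pose k t := tangent p m t - tangent p xi`_i t.
have intk : \int[mu]_(t in `[tau p l u xi i, tau p l u xi i.+1]) k t =
    (tau p l u xi i.+1 - tau p l u xi i) * k m.
  pose A := dpow p m - dpow p xi`_i.
  pose B := intercept p xi`_i - intercept p m.
  have kE t : k t = A * t + B by rewrite /k !tangentE /A /B; ring.
  under eq_Rintegral do rewrite kE.
  by rewrite Rintegral_affine// kE.
apply: (@lt_le_trans _ _ ((tau p l u xi i.+1 - tau p l u xi i) * k m)).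
  apply: mulr_gt0; first by rewrite subr_gt0.
  rewrite /k tangentxx subr_gt0; apply: tangent_lt_fpow => //.
  exact: grid_ge0.
rewrite -intk; apply: le_Rintegral_subitv.
- by move=> t; apply: cvgB; exact: continuous_envelope.
- exact: continuous_tangentB.
- by have := tau_homo (leq0n i) (leqW iin'); rewrite tau0 xil.
- by have := @tau_homo i.+1 n.+1 iin' (leqnn _); rewrite tau_last xiu.
- move=> t tj; rewrite (envelope_grid iin' tj) /k lerD2r.
  by rewrite tangent_le_envelope// !inE eqxx !orbT.
- move=> t tlu tout; rewrite subr_ge0; apply/envelope_leP => x.
  move=> /mem_grid[j jn ->].
  have [ji|ji] := eqVneq j i; last exact/tangent_le_envelope/s_in.
  have [le1|lt1] := leP (tau p l u xi i) t; last first.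
    apply: (@le_trans _ _ (tangent p xi`_i.-1 t)).
      have := @le_tangent_gridS i.-1 t; rewrite prednK// ji => /(_ iin').
      by rewrite [RHS]leNgt lt1 => /negbT; rewrite -ltNge => /ltW.
    apply/tangent_le_envelope/s_in; first exact: leq_trans (leq_pred _) iin'.
    by rewrite neq_ltn ltn_predL i0.
  have lt2 : tau p l u xi i.+1 < t by move: tout; rewrite le1 -ltNge.
  apply: (@le_trans _ _ (tangent p xi`_i.+1 t)).
    by rewrite ji le_tangent_gridS// ltW.
  apply/tangent_le_envelope/s_in => //.
  by rewrite neq_ltn ltnSn orbT.
Qed.

End grid.

(** Induction on i, with d_i = y_i - x_i.  Since d_i <= d_(i+1), monotonicity of
the centroid and [centroid_shift] show that from x to y the centroid of the i-th
cell moves by at most d_(i+1).  Stationarity at i + 1 then forces that of the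
next cell to move by at least d_(i+1), which would fail, again by
[centroid_shift] and monotonicity, if d_(i+2) were smaller than d_(i+1). *)
Lemma stationary_grid_le {R : realType} (q : R) n (x y : nat -> R) : 2 < q ->
  0 <= x 0%N -> x 0%N = y 0%N -> x 1%N <= y 1%N ->
  (forall i, (i < n)%N -> x i < x i.+1) ->
  (forall i, (i < n)%N -> y i < y i.+1) ->
  (forall i, (i.+1 < n)%N ->
     2 * x i.+1 = centroid q (x i) (x i.+1) + centroid q (x i.+1) (x i.+2)) ->
  (forall i, (i.+1 < n)%N ->
     2 * y i.+1 = centroid q (y i) (y i.+1) + centroid q (y i.+1) (y i.+2)) ->
  forall i, (i < n)%N -> 0 <= y i - x i <= y i.+1 - x i.+1.
Proof.
move=> q2 x0 xy0 xy1 xlt ylt sx sy.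
have q1 : 1 < q by lra.
have xge0 i : (i <= n)%N -> 0 <= x i.
  elim: i => // i IH iin.
  by rewrite (le_trans (IH (ltnW iin)))// ltW// xlt.
elim=> [|i IH] iin; first by rewrite xy0 subrr lexx subr_ge0.
have iin' := ltnW iin; have /andP[d0 dle] := IH iin'.
set d := y i.+1 - x i.+1 in dle *.
have d0' : 0 <= d := le_trans d0 dle.
rewrite d0' /=.
have xi0 := xge0 _ (ltnW iin'); have xi10 := xge0 _ iin'.
have yE : y i.+1 = x i.+1 + d by rewrite /d; ring.
have yge0 : 0 <= y i by lra.
have ylti := ylt i iin'; have xlti := xlt i iin'.
have yltS := ylt i.+1 iin; have xltS := xlt i.+1 iin.
have e1 : centroid q (y i) (y i.+1) <= centroid q (x i) (x i.+1) + d.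
  apply: le_trans (centroid_shift q2 xi0 xlti d0').
  by apply: centroid_le => //; lra.
rewrite leNgt; apply/negP => lt2.
have e2 : centroid q (y i.+1) (y i.+2) < centroid q (x i.+1) (x i.+2) + d.
  apply: lt_le_trans (centroid_shift q2 xi10 xltS d0').
  by rewrite -yE; apply: centroid_ltr => //; lra.
have := sx i iin; have := sy i iin; lra.
Qed.

(** * The grid of largest area *)

Section optimal_grid.
Context {R : realType}.
Implicit Types s : seq R.

Lemma exists_notin_itv (a b : R) s : a < b -> exists2 m, a < m < b & m \notin s.
Proof.
elim: s b => [|y s IH] b ab.
  by exists ((a + b) / 2) => //; apply/andP; split; lra.
have [/andP[ay yb]|yab] := boolP (a < y < b).
  have [m /andP[am my] ms] := IH _ ay.
  by exists m; rewrite ?am ?(lt_trans my)// inE negb_or ms lt_eqF.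
have [m mab ms] := IH _ ab.
by exists m; rewrite // inE negb_or ms andbT; apply: contraNneq yab => <-.
Qed.

Context (p l u : R) (n : nat).
Hypotheses (p2 : 2 < p) (l0 : 0 <= l) (lu : l < u) (n2 : (1 < n)%N).

Let p1 : 1 < p. Proof. by rewrite (lt_trans _ p2)// ltr1n. Qed.
Let n0 : (0 < n)%N. Proof. exact: ltnW. Qed.

Definition max_points s := [/\ size s = n.-1, {in s, forall x, l <= x <= u} &
    forall s', size s' = n.-1 -> {in s', forall x, l <= x <= u} ->
      under_area p l u s' <= under_area p l u s].

(** Were a point repeated, or equal to [l] or [u], dropping the repetitions
would leave room for a new point [m] where the envelope is strictly below the
power, hence where the tangent at [m] strictly improves it. *)
Lemma max_points_uniq s : max_points s -> uniq (l :: u :: s).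
Proof.
move=> [sz slu smax].
pose S := [seq x <- undup s | x \notin [:: l; u]].
have [szS|szS] := leqP (size s) (size S).
  have szu : size (undup s) = size s.
    apply/eqP; rewrite eqn_leq size_undup (leq_trans szS)//.
    by rewrite size_filter count_size.
  have us : uniq s by rewrite -[uniq s]negbK -ltn_size_undup szu ltnn.
  have ns : all (fun x => x \notin [:: l; u]) s.
    rewrite all_count eqn_leq count_size/= (leq_trans szS)//.
    by rewrite /S undup_id// size_filter.
  rewrite /= us andbT !inE negb_or lt_eqF//=.
  by apply/andP; split; apply/negP => /(allP ns); rewrite !inE eqxx ?orbT.
have [m /andP[lm mu] ms] := exists_notin_itv (l :: u :: s) lu.
(* Padding with further copies of m restores the number of points. *)
pose s' := m :: S ++ nseq (size s - (size S).+1) m.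
have ss' : {subset l :: u :: s <= l :: u :: s'}.
  move=> x; rewrite !inE mem_cat mem_filter mem_undup !inE.
  by case: (x == l) => //; case: (x == u) => //= ->; rewrite orbT.
have szs' : size s' = n.-1.
  by rewrite /= size_cat size_nseq -sz -addSn subnKC.
have s'lu : {in s', forall x, l <= x <= u}.
  move=> x; rewrite inE mem_cat mem_filter mem_undup.
  case/or3P => [/eqP->|/andP[_ /slu]//|]; first by rewrite !ltW.
  by rewrite mem_nseq => /andP[_ /eqP->]; rewrite !ltW.
have := smax s' szs' s'lu; rewrite leNgt => /negP[].
apply: (@lt_Rintegral_continuous _ _ _ _ _ m).
- exact: continuous_envelope.
- exact: continuous_envelope.
- by rewrite lm.
- by move=> x _; exact: envelope_subset.
- apply: (@lt_le_trans _ _ (fpow p m)).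
    apply: envelope_lt_fpow => //; last by rewrite (le_trans l0)// ltW.
    move=> x; rewrite !inE => /or3P[/eqP->//|/eqP->|/slu/andP[+ _]].
      by rewrite (le_trans l0)// ltW.
    exact: le_trans.
  by rewrite -tangentxx tangent_le_envelope// !inE eqxx !orbT.
Qed.

Lemma max_points_grid s : max_points s ->
  exists2 xi : n.+1.-tuple R, strict_grid l u xi &
    under_area p l u xi = under_area p l u s.
Proof.
move=> smax; have us := max_points_uniq smax; have [sz slu _] := smax.
pose t := sort <=%R (l :: u :: s).
have szt : size t == n.+1 by rewrite size_sort /= sz prednK.
pose xi := Tuple szt.
have mt : xi =i l :: u :: s by move=> x; rewrite mem_sort.
have st : sorted <%R xi.
  by rewrite lt_sorted_uniq_le sort_uniq us sort_le_sorted.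
have tlu x : x \in xi -> l <= x <= u.
  rewrite mt !inE => /or3P[/eqP->|/eqP->|/slu//]; first by rewrite lexx ltW.
  by rewrite lexx andbT ltW.
have tlt i j : (i < j)%N -> (j < n.+1)%N -> xi`_i < xi`_j.
  move=> ij jn; rewrite (sorted_ltn_nth lt_trans)// inE ?size_tuple//.
  exact: ltn_trans jn.
have mi i : (i < n.+1)%N -> l <= xi`_i <= u.
  by move=> iin; rewrite tlu// mem_nth// size_tuple.
exists xi; last first.
  rewrite /under_area (@eq_envelope _ _ _ (u :: xi) l (u :: s))// => x.
  by rewrite !inE mt !inE; case: (x == l) => //; case: (x == u).
split.
- have /(nthP 0)[k] : l \in xi by rewrite mt mem_head.
  rewrite size_tuple => kn kl; have [k0|k0] := posnP k; first by rewrite -k0.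
  have /andP[+ _] := mi 0%N isT.
  by have := tlt _ _ k0 kn; rewrite kl leNgt => ->.
- have /(nthP 0)[k] : u \in xi by rewrite mt !inE eqxx orbT.
  rewrite size_tuple ltnS leq_eqVlt => /orP[/eqP kn|kn] ku.
    by rewrite -{2}kn.
  have /andP[_] := mi n (leqnn _).
  by have := tlt _ _ kn (leqnn _); rewrite ku leNgt => ->.
- by move=> i iin; apply: tlt.
Qed.

(** Domination over all families of points, sorted or not, is what allows
comparing a grid with the unsorted family of [grid_replace_mid]. *)
Lemma exists_dominating_grid : exists xi : n.+1.-tuple R, strict_grid l u xi /\
  forall s, size s = n.-1 -> {in s, forall x, l <= x <= u} ->
    under_area p l u s <= under_area p l u xi.
Proof.
have [s smax] := exists_max_under_area n.-1 p2 l0 (ltW lu).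
have [xi gxi Axi] := max_points_grid smax.
by exists xi; split => //; rewrite Axi; case: smax.
Qed.

Lemma under_area_grid (xi : n.+1.-tuple R) : strict_grid l u xi ->
  exists s, [/\ size s = n.-1, {in s, forall x, l <= x <= u} &
    under_area p l u xi = under_area p l u s].
Proof.
move=> gxi; exists [seq xi`_i | i <- iota 1 n.-1]; split.
- by rewrite size_map size_iota.
- move=> x /mapP[i + ->]; rewrite mem_iota add1n prednK// => /andP[_ /ltnW].
  exact: grid_itv.
- rewrite /under_area (@eq_envelope _ _ _ (u :: xi) l
    (u :: [seq xi`_i | i <- iota 1 n.-1]))// => x.
  apply/idP/idP; last first.
    rewrite !inE => /or3P[->//|->|/mapP[i + ->]]; first by rewrite orbT.
    rewrite mem_iota add1n prednK// => /andP[_ iin].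
    by rewrite mem_nth ?orbT// size_tuple leqW.
  case/(mem_grid gxi) => j jn ->; rewrite !inE; have [xil xiu _] := gxi.
  have [->|j0] := posnP j; first by rewrite xil eqxx.
  move: jn; rewrite leq_eqVlt => /predU1P[->|jn].
    by rewrite xiu eqxx orbT.
  by rewrite map_f ?orbT// mem_iota add1n prednK// j0.
Qed.

Definition optimal_grid (xi : n.+1.-tuple R) := strict_grid l u xi /\
  forall xi' : n.+1.-tuple R, strict_grid l u xi' ->
    under_area p l u xi' <= under_area p l u xi.

Lemma optimal_grid_stationary (xi : n.+1.-tuple R) i :
  optimal_grid xi -> (i.+1 < n)%N ->
  2 * xi`_i.+1 = centroid p xi`_i xi`_i.+1 + centroid p xi`_i.+1 xi`_i.+2.
Proof.
move=> [gxi ximax] iin; rewrite -!(tauS p1 l0 gxi) ?(ltnW iin)//.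
apply/eqP; apply: contraT.
move=> /(@grid_replace_mid _ _ _ _ _ _ p1 l0 n0 gxi i.+1 iin)[s [sz slu]].
have [xi' [gxi' xi'max]] := exists_dominating_grid.
by rewrite ltNge (le_trans (xi'max _ sz slu))// ximax.
Qed.

Lemma optimal_grid_le_eq (x y : n.+1.-tuple R) :
  optimal_grid x -> optimal_grid y -> x`_1 <= y`_1 -> x = y.
Proof.
move=> ox oy xy1; have [gx _] := ox; have [gy _] := oy.
have [x0 xn xlt] := gx; have [y0 yn ylt] := gy.
have d : forall i, (i < n)%N -> 0 <= y`_i - x`_i <= y`_i.+1 - x`_i.+1.
  apply: (stationary_grid_le p2); rewrite ?x0 ?y0// => i iin.
  - exact: optimal_grid_stationary.
  - exact: optimal_grid_stationary.
have dn i j : (i <= j)%N -> (j <= n)%N -> y`_i - x`_i <= y`_j - x`_j.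
  elim: j => [|j IH]; first by rewrite leqn0 => /eqP->.
  rewrite leq_eqVlt => /predU1P[->//|ij] jn.
  by rewrite (le_trans (IH ij (ltnW jn)))//; have /andP[] := d j jn.
apply/val_inj/(@eq_from_nth _ 0); rewrite !size_tuple// => i.
rewrite ltnS => iin; apply/esym/eqP; rewrite -subr_eq0 eq_le; apply/andP; split.
  by rewrite (le_trans (dn i n iin _))// yn xn subrr.
by have := dn 0%N i (leq0n i) iin; rewrite x0 y0 subrr.
Qed.

Lemma optimal_grid_uniq (x y : n.+1.-tuple R) :
  optimal_grid x -> optimal_grid y -> x = y.
Proof.
move=> ox oy; have [xy|/ltW yx] := leP x`_1 y`_1.
  exact: optimal_grid_le_eq.
exact/esym/optimal_grid_le_eq.
Qed.

Lemma exists_optimal_grid : exists xi, optimal_grid xi.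
Proof.
have [xi [gxi ximax]] := exists_dominating_grid.
exists xi; split => // xi' /under_area_grid[s [sz slu ->]]; exact: ximax.
Qed.

End optimal_grid.

(** * Polyhedra in space *)

Section polyhedron.
Context {R : realType}.
Implicit Types (h : R * R * R * R) (w : R * R * R).

Definition affine_form h w :=
  h.1.1.1 * w.1.1 + h.1.1.2 * w.1.2 + h.1.2 * w.2 + h.2.

Definition polyhedron (H : seq (R * R * R * R)) : set (R * R * R) :=
  [set w | {in H, forall h, 0 <= affine_form h w}].

Lemma polyhedron_cons h H :
  polyhedron (h :: H) = affine_form h @^-1` `[0, +oo[ `&` polyhedron H.
Proof.
apply/seteqP; split => w.
  move=> hw; split; last by move=> g gH; apply: hw; rewrite inE gH orbT.
  by rewrite /= in_itv/= andbT; apply: hw; rewrite mem_head.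
case; rewrite /= in_itv/= andbT => w0 wH g; rewrite inE => /predU1P[->//|].
exact: wH.
Qed.

Lemma polyhedron_nil : polyhedron [::] = setT.
Proof. by apply/seteqP; split. Qed.

Lemma continuous_affine h : continuous (affine_form h : R^o * R^o * R^o -> R).
Proof.
move=> w; rewrite /affine_form.
have c1 : (fun w : R^o * R^o * R^o => w.1.1) w' @[w' --> w] --> w.1.1.
  by apply: (@continuous_comp _ _ _ fst fst); exact: cvg_fst.
have c2 : (fun w : R^o * R^o * R^o => w.1.2) w' @[w' --> w] --> w.1.2.
  apply: (@continuous_comp _ _ _ fst snd); first exact: cvg_fst.
  exact: cvg_snd.
have c3 : (fun w : R^o * R^o * R^o => w.2) w' @[w' --> w] --> w.2.
  exact: cvg_snd.
apply: cvgD; last exact: cvg_cst.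
apply: cvgD; last by apply: cvgM; [exact: cvg_cst|].
by apply: cvgD; apply: cvgM => //; exact: cvg_cst.
Qed.

Lemma closed_polyhedron H : closed (polyhedron H : set (R^o * R^o * R^o)).
Proof.
elim: H => [|h H IH]; first by rewrite polyhedron_nil; exact: closedT.
rewrite polyhedron_cons; apply: closedI => //.
apply: preimage_closed; last exact: interval_closed.
by move=> w _; exact: continuous_affine.
Qed.

Lemma measurable_affine h : measurable_fun setT (affine_form h).
Proof.
rewrite /affine_form; apply: measurable_funD => //.
have m1 : measurable_fun setT (fst : R * R * R -> R * R).
  exact: measurable_fst.
have m2 : measurable_fun setT (snd : R * R * R -> R).
  exact: measurable_snd.
have m11 : measurable_fun setT (fun w : R * R * R => w.1.1).
  exact: measurableT_comp measurable_fst m1.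
have m12 : measurable_fun setT (fun w : R * R * R => w.1.2).
  exact: measurableT_comp measurable_snd m1.
by apply: measurable_funD; [apply: measurable_funD|]; apply: measurable_funM.
Qed.

Lemma measurable_polyhedron H : measurable (polyhedron H).
Proof.
elim: H => [|h H IH]; first by rewrite polyhedron_nil.
rewrite polyhedron_cons; apply: measurableI => //.
by rewrite -[X in measurable X]setTI; apply: measurable_affine.
Qed.

Lemma affine_form_conv h (k : R) (w1 w2 : R^o * R^o * R^o) :
  affine_form h (k *: w1 + (1 - k) *: w2) =
  k * affine_form h w1 + (1 - k) * affine_form h w2.
Proof. by rewrite /affine_form /= /GRing.scale/=; ring. Qed.

Lemma polyhedron_conv H (k : R) (w1 w2 : R^o * R^o * R^o) : 0 <= k <= 1 ->
  polyhedron H w1 -> polyhedron H w2 ->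
  polyhedron H (k *: w1 + (1 - k) *: w2).
Proof.
move=> /andP[k0 k1] h1 h2 h hH; rewrite affine_form_conv.
by rewrite addr_ge0// mulr_ge0 ?subr_ge0// ?h1 ?h2.
Qed.

End polyhedron.

(** * Iterated integrals *)

Lemma product_measureE d1 d2 (T1 : measurableType d1) (T2 : measurableType d2)
    (R : realType) (m1 : {sigma_finite_measure set T1 -> \bar R})
    (m2 : {sigma_finite_measure set T2 -> \bar R}) (A : set (T1 * T2)) :
  measurable A ->
  ((m1 \x m2) A = \int[m2]_y m1 (ysection A y))%E.
Proof.
have h (B : set T1) (C : set T2) : measurable B -> measurable C ->
    ((m1 \x^ m2) (B `*` C) = m1 B * m2 C)%E.
  by move=> mB mC; rewrite product_measure2E.
by move=> mA; rewrite (product_measure_unique h).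
Qed.

Lemma sigma_finite_product_measure d1 d2 (T1 : measurableType d1)
    (T2 : measurableType d2) (R : realType)
    (m1 : {sigma_finite_measure set T1 -> \bar R})
    (m2 : {sigma_finite_measure set T2 -> \bar R}) :
  sigma_finite setT (m1 \x m2)%E.
Proof.
have /sigma_finiteP[F [TF ndF Foo]] := sigma_finiteT m1.
have /sigma_finiteP[G [TG ndG Goo]] := sigma_finiteT m2.
exists (fun n => F n `*` G n) => [|n].
  apply/seteqP; split => // -[x y] _.
  have [i _ Fx] : (\bigcup_i F i) x by rewrite -TF.
  have [j _ Gy] : (\bigcup_i G i) y by rewrite -TG.
  exists (maxn i j) => //; split => /=.
    by move: x Fx; exact/subsetPset/ndF/leq_maxl.
  by move: y Gy; exact/subsetPset/ndG/leq_maxr.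
have [mF Fn] := Foo n; have [mG Gn] := Goo n.
split; first exact: measurableX.
by rewrite product_measure1E// lte_mul_pinfty// ge0_fin_numE.
Qed.

(** The order of integration is the one suited to a cone: the height z
outermost, then x, then the length in the direction y. *)
Lemma product_measure3E d1 d2 d3 (T1 : measurableType d1)
    (T2 : measurableType d2) (T3 : measurableType d3) (R : realType)
    (m1 : {sigma_finite_measure set T1 -> \bar R})
    (m2 : {sigma_finite_measure set T2 -> \bar R})
    (m3 : {sigma_finite_measure set T3 -> \bar R}) (A : set (T1 * T2 * T3)) :
  measurable A ->
  ((m1 \x m2 \x m3) A = \int[m3]_z \int[m1]_x m2 [set y | A (x, y, z)])%E.
Proof.
move=> mA.
pose m12 : {sigma_finite_measure set (T1 * T2)%type -> \bar R} :=
  HB.pack (m1 \x m2)%E (@Measure_isSigmaFinite.Build _ _ _ (m1 \x m2)%E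
    (sigma_finite_product_measure m1 m2)).
rewrite -[LHS]/((m12 \x m3) A)%E product_measureE//.
apply: eq_integral => z _ /=; apply: eq_integral => x _ /=; congr (m2 _).
by apply/seteqP; split => y; rewrite /xsection/= /ysection/= !inE/= inE.
Qed.

Lemma vol3_iterated (R : realType) (A : set (R * R * R)) : measurable A ->
  vol3 A = (\int[lebesgue_measure]_z \int[lebesgue_measure]_x
    lebesgue_measure [set y | A (x, y, z)])%E.
Proof.
move=> mA; exact: (@product_measure3E _ _ _ _ _ _ R
  lebesgue_measure lebesgue_measure lebesgue_measure A mA).
Qed.

Lemma integral_dilation (R : realType) (g : R -> R) a b c :
  continuous g -> a <= b -> 0 <= c ->
  (\int[@lebesgue_measure R]_(x in `[(c * a)%R, (c * b)%R]) (g (x / c))%:E =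
   \int[@lebesgue_measure R]_(t in `[a, b]) (g t * c)%:E)%E.
Proof.
move=> cg ab; rewrite le_eqVlt => /predU1P[<-|c0].
  rewrite !mul0r set_itv1 integral_set1 integral0_eq// => t _.
  by rewrite mulr0.
pose F (t : R) := c * t.
have dF (t : R) : is_derive t 1 F c.
  rewrite /F; apply: is_derive_eq; rewrite /GRing.scale/= mulr1//.
have dF1 : F^`()%classic = cst c.
  by apply/funext => t; rewrite derive1E; have [_ ->] := dF t.
have cF : continuous F.
  move=> t; apply: differentiable_continuous; apply/derivable1_diffP.
  by have [] := dF t.
rewrite -/(F a) -/(F b).
rewrite (@integration_by_substitution_increasing _ F (fun x => g (x / c)))//.
- apply: eq_integral => t _; rewrite dF1 -[LHS]/((g (c * t / c) * c)%:E).
  by rewrite mulrAC divff ?mul1r ?gt_eqF.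
- by move=> x y _ _; rewrite /F ltr_pM2l.
- by rewrite dF1 => t _; exact: cvg_cst.
- by rewrite dF1; exact: is_cvg_cst.
- by rewrite dF1; exact: is_cvg_cst.
- split.
  + by move=> t _; have [] := dF t.
  + by apply: cvg_at_right_filter; exact: cF.
  + by apply: cvg_at_left_filter; exact: cF.
- apply: continuous_subspaceT => x.
  have cd : (fun y => y / c) y @[y --> x] --> x / c.
    by apply: cvgM; [exact: cvg_id|exact: cvg_cst].
  exact: (cvg_comp _ _ cd (cg _)).
Qed.

Lemma integral_sqr (R : realType) :
  (\int[@lebesgue_measure R]_(z in `[0%R, 1%R]) (z ^+ 2)%:E =
   (3^-1 : R)%:E)%E.
Proof.
pose F (t : R) := 3^-1 * t ^+ 3.
have dF (t : R) : is_derive t 1 F (t ^+ 2).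
  rewrite /F; apply: is_derive_eq.
  by rewrite /GRing.scale/=; field.
have cF : continuous F.
  move=> t; apply: differentiable_continuous; apply/derivable1_diffP.
  by have [] := dF t.
rewrite (@continuous_FTC2 _ (fun t => t ^+ 2) F)//=.
- by rewrite /F expr1n expr0n/= mulr0 mulr1 -EFinB subr0.
- by apply: continuous_subspaceT => t; exact: exprn_continuous.
- split.
  + by move=> t _; have [] := dF t.
  + by apply: cvg_at_right_filter; exact: cF.
  + by apply: cvg_at_left_filter; exact: cF.
- by move=> t _; rewrite derive1E; have [_ ->] := dF t.
Qed.

(** * The closed convex hull as a polyhedral cone *)

Section cone.
Context {R : realType}.
Local Notation mu := (@lebesgue_measure R).
Context (p l u : R).
Hypotheses (p1 : 1 < p) (l0 : 0 <= l) (lu : l < u).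
Implicit Types s : seq R.

Definition slope := (fpow p u - fpow p l) / (u - l).
Definition secant t := fpow p l - slope * l + slope * t.

(** An affine function below another one at [l] and at [u] is so in between. *)
Lemma tangent_le_secant x t : 0 <= x -> l <= t <= u ->
  tangent p x t <= secant t.
Proof.
move=> x0 /andP[lt tu].
have ul : 0 < u - l by rewrite subr_gt0.
have Tl := tangent_le_fpow p1 x0 l0.
have Tu := tangent_le_fpow p1 x0 (le_trans l0 (ltW lu)).
rewrite -subr_ge0 -(pmulr_rge0 _ ul).
have -> : (u - l) * (secant t - tangent p x t) =
    (u - t) * (fpow p l - tangent p x l) + (t - l) * (fpow p u - tangent p x u).
  by rewrite /secant /slope /tangent; field; rewrite gt_eqF.
by rewrite addr_ge0// mulr_ge0// subr_ge0.
Qed.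

Lemma envelope_le_secant s t : {in s, forall x, 0 <= x} -> l <= t <= u ->
  envelope p l s t <= secant t.
Proof.
move=> s0 tlu; apply/envelope_leP => x; rewrite inE => /predU1P[->|/s0 x0];
  exact: tangent_le_secant.
Qed.

(** The inequalities of the homogenized region between the envelope and the
chord: 0 <= z, z <= 1, l z <= x, x <= u z, the chord, the tangents. *)
Definition facets s : seq (R * R * R * R) :=
  [:: (0, 0, 1, 0); (0, 0, -1, 1); (1, 0, - l, 0); (-1, 0, u, 0);
      (slope, -1, fpow p l - slope * l, 0)] ++
  [seq (- dpow p r, 1, intercept p r, 0) | r <- l :: s].

Lemma polyhedron_facets s x y z : polyhedron (facets s) (x, y, z) <->
  [/\ 0 <= z <= 1, l * z <= x <= u * z,
      y <= (fpow p l - slope * l) * z + slope * x &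
      forall r, r \in l :: s -> dpow p r * x - intercept p r * z <= y].
Proof.
split=> [h|[/andP[z0 z1] /andP[lx xu] ys yr] h].
  have := h (0, 0, 1, 0) (mem_head _ _); rewrite /affine_form/= => h1.
  have : 0 <= affine_form (0, 0, -1, 1) (x, y, z).
    by apply: h; rewrite !inE eqxx ?orbT.
  rewrite /affine_form/= => h2.
  have : 0 <= affine_form (1, 0, - l, 0) (x, y, z).
    by apply: h; rewrite !inE eqxx ?orbT.
  rewrite /affine_form/= => h3.
  have : 0 <= affine_form (-1, 0, u, 0) (x, y, z).
    by apply: h; rewrite !inE eqxx ?orbT.
  rewrite /affine_form/= => h4.
  have : 0 <= affine_form (slope, -1, fpow p l - slope * l, 0) (x, y, z).
    by apply: h; rewrite !inE eqxx ?orbT.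
  rewrite /affine_form/= => h5.
  split; try by [lra|apply/andP; split; lra].
  move=> r rs.
  have : 0 <= affine_form (- dpow p r, 1, intercept p r, 0) (x, y, z).
    by apply: h; rewrite mem_cat map_f ?orbT.
  by rewrite /affine_form/=; lra.
rewrite mem_cat => /orP[|/mapP[r /yr yr' ->]].
  2: by rewrite /affine_form/=; lra.
by rewrite !inE => /or4P[|||/orP[]] /eqP->; rewrite /affine_form/=; lra.
Qed.

Lemma envelope_perspectiveP s x y z : 0 < z ->
  reflect (forall r, r \in l :: s -> dpow p r * x - intercept p r * z <= y)
    (z * envelope p l s (x / z) <= y).
Proof.
move=> z0; rewrite mulrC -ler_pdivlMr//.
have E r : tangent p r (x / z) <= y / z =
    (dpow p r * x - intercept p r * z <= y).
  rewrite ler_pdivlMr// tangentE mulrBl; congr (_ - _ <= _).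
  by rewrite -mulrA divfK ?gt_eqF.
by apply: (iffP (envelope_leP _ _ _ _ _)) => h r /h; rewrite E.
Qed.

(** Multiplying by z > 0 turns the inequality with the envelope at x / z into
one linear inequality for each tangent; that of the tangent at [l] entails
y >= 0. *)
Lemma Ubase_polyhedron n (xi : n.+1.-tuple R) :
  (0 < n)%N -> strict_grid l u xi ->
  Ubase p l u xi = polyhedron (facets (u :: xi)) `&` [set w | 0 < w.2].
Proof.
move=> n0 gxi; apply/seteqP; split => -[[x y] z] /=.
  move=> [[ys yg] [xu lx] [z0 z1] y0]; split => //; apply/polyhedron_facets.
  split; rewrite ?(ltW z0)// ?lx//; apply/envelope_perspectiveP => //.
  rewrite -(gpl_envelope p1 l0 n0 gxi)//.
  by rewrite ler_pdivlMr// lx ler_pdivrMr.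
move=> [/polyhedron_facets[/andP[_ z1] /andP[lx xu] ys yr] z0].
split => //.
  split => //; rewrite (gpl_envelope p1 l0 n0 gxi).
    exact/envelope_perspectiveP.
  by rewrite ler_pdivlMr// lx ler_pdivrMr.
apply: le_trans (yr l (mem_head _ _)).
have -> : dpow p l * x - intercept p l * z =
    fpow p l * z + dpow p l * (x - l * z).
  by rewrite /intercept; ring.
rewrite addr_ge0// mulr_ge0 ?dpow_ge0 ?subr_ge0 ?powR_ge0// ltW//.
exact: lt_trans p1.
Qed.

Lemma convex_Ubase n (xi : n.+1.-tuple R) : (0 < n)%N -> strict_grid l u xi ->
  convex_set (Ubase p l u xi).
Proof.
move=> n0 gxi; rewrite Ubase_polyhedron//.
apply/convex_setW => w1 w2; rewrite !inE => -[h1 z1] [h2 z2] k k0 k1.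
rewrite inE; split; first by apply: polyhedron_conv; rewrite ?ltW.
by rewrite /= addr_gt0// mulr_gt0// subr_gt0.
Qed.

(** The cone is convex, and its only point with z = 0 is the apex, which is a
limit of points on the ray through (l, f(l), 1). *)
Lemma Ustar_polyhedron n (xi : n.+1.-tuple R) :
  (0 < n)%N -> strict_grid l u xi ->
  Ustar p l u xi = polyhedron (facets (u :: xi)).
Proof.
move=> n0 gxi.
have hullE : conv_hull (Ubase p l u xi) = Ubase p l u xi.
  exact/smallest_id/convex_Ubase.
rewrite /Ustar hullE; apply/seteqP; split.
  rewrite closureE; apply: smallest_sub; first exact: closed_polyhedron.
  by rewrite Ubase_polyhedron// => w [].
move=> [[x y] z] h.
have [z0|z0] := ltP 0 z.
  by apply: subset_closure; rewrite Ubase_polyhedron.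
have /polyhedron_facets[/andP[z0' _] /andP[lx xu] ys yr] := h.
have {z0 z0'}zE : z = 0 by apply/eqP; rewrite eq_le z0.
move: lx xu ys yr; rewrite zE !mulr0 => lx xu.
have {lx xu}xE : x = 0 by apply/eqP; rewrite eq_le xu.
rewrite xE !mulr0 addr0 => y0 /(_ l (mem_head _ _)).
rewrite !mulr0 subr0 => y0'.
have {y0 y0'}-> : y = 0 by apply/eqP; rewrite eq_le y0.
move=> B B0.
pose w0 : R^o * R^o * R^o := (l, fpow p l, 1).
pose phi (t : R) := t *: w0.
have phi0 : phi 0 = (0, 0, 0) by rewrite /phi scale0r.
have cphi : {for 0, continuous phi} by exact: scalel_continuous.
have /nbhs_ballP[d /= d0 dB] : nbhs (0 : R) (phi @^-1` B).
  by apply: cphi; rewrite phi0.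
pose t := Num.min (d / 2) 1.
have t0 : 0 < t by rewrite lt_min ltr01 andbT divr_gt0.
have td : t < d.
  by rewrite /t gt_min ltr_pdivrMr// mulr_natr mulr2n ltrDl d0.
exists (phi t); split.
  2: by apply: dB; rewrite /ball/= sub0r normrN gtr0_norm.
have -> : phi t = (t * l, t * fpow p l, t * 1) by [].
rewrite mulr1 Ubase_polyhedron//; split => //; apply/polyhedron_facets; split.
- by rewrite (ltW t0)/= /t ge_min lexx orbT.
- by rewrite mulrC lexx/= mulrC ler_pM2r// ltW.
- by rewrite le_eqVlt; apply/orP; left; apply/eqP; ring.
- move=> r rs.
  have r0 : 0 <= r.
    by have [j jn ->] := mem_grid gxi rs; exact: (grid_ge0 l0 gxi).
  have := tangent_le_fpow p1 r0 l0; rewrite tangentE => h1.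
  have := ler_wpM2l (ltW t0) h1; lra.
Qed.

End cone.

(** * The volume *)

Section volume.
Context {R : realType}.
Local Notation mu := (@lebesgue_measure R).
Context (p l u : R).
Hypotheses (p1 : 1 < p) (l0 : 0 <= l) (lu : l < u).
Implicit Types s : seq R.

Definition gap s t := secant p l u t - envelope p l s t.

Lemma continuous_gap s : continuous (gap s).
Proof.
move=> t; apply: cvgB; last exact: continuous_envelope.
by apply: cvgD; [exact: cvg_cst|apply: cvgM; [exact: cvg_cst|exact: cvg_id]].
Qed.

(** For z = 0 this still holds: then x = 0, the section is a point, and both
sides vanish. *)
Lemma section_length s x z : {in s, forall r, 0 <= r} -> 0 <= z <= 1 ->
  l * z <= x <= u * z ->
  mu [set y | polyhedron (facets p l u s) (x, y, z)] = (z * gap s (x / z))%:E.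
Proof.
move=> s0 z01 xz; have /andP[z0 z1] := z01.
have E y : polyhedron (facets p l u s) (x, y, z) <->
   y <= (fpow p l - slope p l u * l) * z + slope p l u * x /\
   (forall r, r \in l :: s -> dpow p r * x - intercept p r * z <= y).
  split; first by move=> /polyhedron_facets[].
  by move=> [? ?]; apply/polyhedron_facets; split.
move: z0; rewrite le_eqVlt => /predU1P[z0|z0].
  have x0 : x = 0.
    by move: xz; rewrite -z0 !mulr0 => xz; apply/eqP; rewrite eq_le andbC.
  rewrite (_ : [set y | _] = [set 0]).
    by rewrite lebesgue_measure_set1 -z0 mul0r.
  apply/seteqP; split => y /=.
    move/E; rewrite -z0 x0 !mulr0 addr0 => -[y0 /(_ l (mem_head _ _))].
    by rewrite !mulr0 subr0 => y0'; apply/eqP; rewrite eq_le y0.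
  move=> ->; apply/E; rewrite -z0 x0 !mulr0 addr0; split=> // r _.
  by rewrite !mulr0 subr0.
rewrite (_ : [set y | _] = `[z * envelope p l s (x / z),
    z * secant p l u (x / z)]%classic); last first.
  have sE : z * secant p l u (x / z) =
      (fpow p l - slope p l u * l) * z + slope p l u * x.
    by rewrite /secant; field; rewrite gt_eqF.
  apply/seteqP; split => y /=; rewrite in_itv/= sE.
    move/E => [-> yr]; rewrite andbT.
    exact/envelope_perspectiveP.
  move=> /andP[/envelope_perspectiveP yr ys]; apply/E; split => //.
  exact: yr.
have zt : l <= x / z <= u.
  by rewrite ler_pdivlMr// ler_pdivrMr.
have := envelope_le_secant p1 l0 lu s0 zt.
rewrite lebesgue_measure_itv/= lte_fin ltr_pM2l// le_eqVlt => /predU1P[e|e].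
  by rewrite e ltxx /gap e subrr mulr0.
by rewrite e -EFinB -mulrBr.
Qed.

Lemma vol3_facets s : {in s, forall r, 0 <= r} ->
  vol3 (polyhedron (facets p l u s)) =
  (3^-1 * \int[mu]_(t in `[l, u]) gap s t)%:E.
Proof.
move=> s0; rewrite vol3_iterated; last exact: measurable_polyhedron.
have ig : mu.-integrable `[l, u] (EFin \o gap s).
  exact/integrable_continuous/continuous_gap.
transitivity (\int[mu]_z
    ((fun z => (z ^+ 2 * \int[mu]_(t in `[l, u]) gap s t)%:E)
     \_ `[0%R, 1%R]) z)%E.
  apply: eq_integral => z _; rewrite patchE; case: ifPn => [|z01].
    rewrite inE/= in_itv/= => z01; have /andP[z0 _] := z01.
    transitivity (\int[mu]_(x in `[(z * l)%R, (z * u)%R])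
        (z * gap s (x / z))%:E)%E.
      rewrite [RHS]integral_mkcond; apply: eq_integral => x _.
      rewrite patchE; case: ifPn => [|xz].
        rewrite inE/= in_itv/= => xz; rewrite section_length//.
        by rewrite mulrC (mulrC u).
      rewrite (_ : [set y | _] = set0) ?measure0//.
      apply/seteqP; split => // y /= /polyhedron_facets[_ lx _ _].
      by move: xz; rewrite notin_setE/= in_itv/= (mulrC z) (mulrC z) lx.
    rewrite (@integral_dilation R (fun t => z * gap s t))//; last exact: ltW.
      rewrite /Rintegral EFinM fineK; last exact: integrable_fin_num.
      rewrite -integralZl//; apply: eq_integral => t _.
      by rewrite -EFinM expr2 mulrAC.
    by move=> t; apply: cvgM; [exact: cvg_cst|exact: continuous_gap].
  rewrite integral0_eq// => x _; rewrite (_ : [set y | _] = set0) ?measure0//.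
  apply/seteqP; split => // y /= /polyhedron_facets[z01' _ _ _].
  by move: z01; rewrite notin_setE/= in_itv/= z01'.
rewrite -integral_mkcond.
under eq_integral do rewrite mulrC EFinM.
rewrite integralZl//; first by rewrite integral_sqr -EFinM mulrC.
by apply: integrable_continuous => z; exact: exprn_continuous.
Qed.

Lemma Rintegral_gap s : \int[mu]_(t in `[l, u]) gap s t =
  \int[mu]_(t in `[l, u]) secant p l u t -
  \int[mu]_(t in `[l, u]) envelope p l s t.
Proof.
rewrite RintegralB//; last exact: integrable_envelope.
apply: integrable_continuous => t.
by apply: cvgD; [exact: cvg_cst|apply: cvgM; [exact: cvg_cst|exact: cvg_id]].
Qed.

Lemma vol3_Ustar n (xi : n.+1.-tuple R) : (0 < n)%N -> strict_grid l u xi ->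
  vol3 (Ustar p l u xi) =
  (3^-1 * (\int[mu]_(t in `[l, u]) secant p l u t - under_area p l u xi))%:E.
Proof.
move=> n0 gxi; rewrite Ustar_polyhedron// vol3_facets ?Rintegral_gap// => r rs.
have [j jn ->] : exists2 j, (j <= n)%N & r = xi`_j.
  by apply: (mem_grid gxi); rewrite inE rs orbT.
exact: (grid_ge0 l0 gxi).
Qed.

End volume.

Theorem corollary3p10 (R : realType) (p l u : R) (n : nat)
    (hp : 2 < p) (hl : 0 <= l) (hlu : l < u) (hn : (2 <= n)%N) :
  exists! xi : n.+1.-tuple R,
    strict_grid l u xi /\
    (forall xi' : n.+1.-tuple R, strict_grid l u xi' ->
       (vol3 (Ustar p l u xi) <= vol3 (Ustar p l u xi'))%E).
Proof.
have p1 : 1 < p by rewrite (lt_trans _ hp)// ltr1n.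
have n0 : (0 < n)%N by exact: ltnW.
have volE (x y : n.+1.-tuple R) : strict_grid l u x -> strict_grid l u y ->
    (vol3 (Ustar p l u x) <= vol3 (Ustar p l u y))%E =
    (under_area p l u y <= under_area p l u x).
  move=> gx gy; rewrite (vol3_Ustar p1 hl hlu n0 gx).
  rewrite (vol3_Ustar p1 hl hlu n0 gy) lee_fin ler_pM2l ?invr_gt0//.
  by rewrite lerD2l lerN2.
have optP (x : n.+1.-tuple R) : optimal_grid p l u x <-> strict_grid l u x /\
    (forall y : n.+1.-tuple R, strict_grid l u y ->
       (vol3 (Ustar p l u x) <= vol3 (Ustar p l u y))%E).
  split=> -[gx xmax]; split=> [//|y gy]; have := xmax y gy;
    by rewrite (volE _ _ gx gy).
have [xi xiopt] := exists_optimal_grid hp hl hlu hn.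
exists xi; split; first exact/optP.
by move=> y /optP yopt; exact: (optimal_grid_uniq hp hl hlu hn).
Qed.
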